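(* Assume Condition C holds and the walk is transient to the right, $X_n\to+\infty$ (i.e. $\xi_n\to+\infty$) $\mathbb{P}^\mu$-a.s., where the initial distribution is $P_\omega^\mu(\xi_0=0,\,Y_0=i)=\mu_\omega(i)$, $i\in\mathscr{D}$, for $P$-a.e. $\omega$, with $\mu=(\mu_\omega)\in\mathcal{M}_d$. Then $$\mathbb{E}^\mu T_1=E\Big(\mu_\omega\big(u_0+A_0u_{-1}+\cdots+A_0A_{-1}\cdots A_{-k}u_{-k-1}+\cdots\big)\Big).$$
   Context: Environment. Fix an integer $d\ge1$, $\mathscr{D}=\{1,\dots,d\}$. $(P_n,Q_n,R_n)_{n\in\mathbb{Z}}$ is a strictly stationary ergodic sequence of triples of $d\times d$ matrices with non-negative entries such that $P_n+Q_n+R_n$ is stochastic for every $n$. $\Omega$ is the space of all sequences $\omega=(\omega_n)=((P_n,Q_n,R_n))_{n\in\mathbb{Z}}$ of such triples, $\mathscr{F}$ its natural $\sigma$-algebra, $P$ the law of the sequence, $E$ its expectation, and $\theta$ the shift, $(\theta\omega)_n=\omega_{n+1}$. $I$ is the identity matrix, $\mathbf{1}$ is the all-ones column vector, and $\|A\|=\max_i\sum_j|a(i,j)|$ for a matrix $A=(a(i,j))$. Walk. $\mathcal{M}_d$ is the set of families $\mu=(\mu_\omega)_{\omega\in\Omega}$ with each $\mu_\omega$ a probability (row) vector on $\mathscr{D}$. Given $\omega$ and $\mu\in\mathcal{M}_d$, the quenched law $P_\omega^\mu$ is that of the time-homogeneous Markov chain $X_n=(\xi_n,Y_n)$, $n\ge0$,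 on $S=\mathbb{Z}\times\mathscr{D}$ with $\xi_0=0$, $Y_0\sim\mu_\omega$, which from $(n,i)$ moves to $(n+1,j)$ with probability $P_n(i,j)$, to $(n,j)$ with probability $R_n(i,j)$, and to $(n-1,j)$ with probability $Q_n(i,j)$. The annealed law is $\mathbb{P}^\mu(F\times G)=\int_F P_\omega^\mu(G)\,P(d\omega)$, with expectation $\mathbb{E}^\mu$. The layer $n$ is $L_n=\{(n,j):1\le j\le d\}$, and $T_1=\inf\{t\ge0: X_t\in L_1\}$. Condition C. (C1) $(\Omega,\mathscr{F},P,\theta)$ is ergodic. (C2) $E\log(1-\|R_n+P_n\|)^{-1}<\infty$ and $E\log(1-\|R_n+Q_n\|)^{-1}<\infty$. (C3) For all $j\in\mathscr{D}$ and all $n$, $\sum_{i=1}^dQ_n(i,j)>0$ and $\sum_{i=1}^dP_n(i,j)>0$, $P$-a.s. (C4) With positive $P$-probability, the layer $0$ is in one communication class of the chain. Matrices. Under Condition C, $(\zeta_n)_{n\in\mathbb{Z}}$ denotes the ($P$-a.s. unique) sequence of stochastic $d\times d$ matrices satisfying $\zeta_n=(I-Q_n\zeta_{n-1}-R_n)^{-1}P_n$ for all $n\in\mathbb{Z}$, and $$A_n:=(I-Q_n\zeta_{n-1}-R_n)^{-1}Q_n,\qquad u_n:=(I-Q_n\zeta_{n-1}-R_n)^{-1}\mathbf{1}.$$ Standing assumption: $\lambda^+:=\lim_{n\to\infty}\frac1n\log\|A_nA_{n-1}\cdots A_1\|<0$; under Condition C this is known to be equivalent to transience to the right. *)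

(* Defs.v *)
From HB Require Import structures.
From mathcomp Require Import all_boot all_order all_algebra.
From mathcomp Require Import all_classical all_reals all_analysis.

Set Implicit Arguments.
Unset Strict Implicit.
Unset Printing Implicit Defensive.

Import Order.TTheory GRing.Theory Num.Theory.
Import numFieldNormedType.Exports.

Local Open Scope classical_set_scope.
Local Open Scope ring_scope.

(* Throughout, the number of points of a layer is d.+1, so that it is >= 1. *)

Definition nonneg_mx (R : realType) (m n : nat) (A : 'M[R]_(m, n)) : bool :=
  [forall i, forall j, 0 <= A i j].

Definition stochastic_mx (R : realType) (m n : nat) (A : 'M[R]_(m, n)) : bool :=
  nonneg_mx A && [forall i, \sum_j A i j == 1].

Definition row_norm (R : realType) (m n : nat) (A : 'M[R]_(m, n)) : R :=
  \big[Num.max/0]_i \sum_j `|A i j|.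

(* A triple (P, Q, R), encoded as ((P, Q), R). *)
Definition is_site (R : realType) (d : nat)
    (m : 'M[R]_d.+1 * 'M[R]_d.+1 * 'M[R]_d.+1) : bool :=
  [&& nonneg_mx m.1.1, nonneg_mx m.1.2, nonneg_mx m.2
    & stochastic_mx (m.1.1 + m.1.2 + m.2)].

Definition site (R : realType) (d : nat) : Type :=
  {m : 'M[R]_d.+1 * 'M[R]_d.+1 * 'M[R]_d.+1 | is_site m}.

HB.instance Definition _ (R : realType) (d : nat) := Choice.copy (site R d)
  {m : 'M[R]_d.+1 * 'M[R]_d.+1 * 'M[R]_d.+1 | is_site m}.

Lemma is_site_id (R : realType) (d : nat) : @is_site R d (1%:M, 0, 0).
Proof.
rewrite /is_site /stochastic_mx /nonneg_mx /= !addr0.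
have h0 : [forall i, forall j, 0 <= (0 : 'M[R]_d.+1) i j].
  by apply/forallP => i; apply/forallP => j; rewrite mxE.
have h1 : [forall i, forall j, 0 <= (1%:M : 'M[R]_d.+1) i j].
  by apply/forallP => i; apply/forallP => j; rewrite mxE ler0n.
rewrite !h0 h1 /=; apply/forallP => i; rewrite (bigD1 i) //= mxE eqxx.
rewrite big1 ?addr0 // => j ji; rewrite mxE eq_sym.
by rewrite (negbTE ji).
Qed.

HB.instance Definition _ (R : realType) (d : nat) :=
  isPointed.Build (site R d) (exist (fun m => is_site m) (1%:M, 0, 0) (is_site_id R d)).

Definition env_seq (R : realType) (d : nat) : Type := int -> site R d.

HB.instance Definition _ (R : realType) (d : nat) := Pointed.on (env_seq R d).

Definition Pmx (R : realType) (d : nat) (w : env_seq R d) (n : int) :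
  'M[R]_d.+1 := (sval (w n)).1.1.
Definition Qmx (R : realType) (d : nat) (w : env_seq R d) (n : int) :
  'M[R]_d.+1 := (sval (w n)).1.2.
Definition Rmx (R : realType) (d : nat) (w : env_seq R d) (n : int) :
  'M[R]_d.+1 := (sval (w n)).2.

Definition env_cylinders (R : realType) (d : nat) : set (set (env_seq R d)) :=
  [set C | exists (n : int) (i j : 'I_d.+1) (B : set R),
     measurable B /\
     [\/ C = [set w | B (Pmx w n i j)],
         C = [set w | B (Qmx w n i j)] |
         C = [set w | B (Rmx w n i j)]]].

(* Omega with its natural (product) sigma-algebra. *)
Definition env (R : realType) (d : nat) :=
  g_sigma_algebraType (@env_cylinders R d).

Definition shift (R : realType) (d : nat) (w : env R d) : env R d :=
  fun n => w (n + 1).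

Definition stationary (R : realType) (d : nat)
    (P : probability (env R d) R) : Prop :=
  forall B : set (env R d), measurable B -> P (@shift R d @^-1` B) = P B.

Definition ergodic (R : realType) (d : nat)
    (P : probability (env R d) R) : Prop :=
  forall B : set (env R d), measurable B -> @shift R d @^-1` B = B ->
    P B = 0%E \/ P B = 1%E.

(* The strip Z x {1, ..., d}. *)
Definition state (d : nat) : Type := (int * 'I_d.+1)%type.

HB.instance Definition _ (d : nat) :=
  Choice.copy (state d) (int * 'I_d.+1)%type.
HB.instance Definition _ (d : nat) := isPointed.Build (state d) (0, ord0).

Definition layer (d : nat) (n : int) : set (state d) := [set x | x.1 = n].

Definition transition (R : realType) (d : nat) (w : env R d)
    (x y : state d) : R :=
  if y.1 == x.1 + 1 then Pmx w x.1 x.2 y.2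
  else if y.1 == x.1 then Rmx w x.1 x.2 y.2
  else if y.1 == x.1 - 1 then Qmx w x.1 x.2 y.2
  else 0.

Definition leads_to (R : realType) (d : nat) (w : env R d)
    (x y : state d) : Prop :=
  exists s : seq (state d),
    path (fun a b => 0 < transition w a b) x s /\ last x s = y.

Definition layer_communicates (R : realType) (d : nat) (w : env R d)
    (n : int) : Prop :=
  forall x y : state d, layer n x -> layer n y -> leads_to w x y.

(* In the second and third clauses the logarithm is extended-real-valued:
   0^-1 = +oo and lne +oo = +oo, so that integrability forces the norms to be
   almost surely < 1. *)
Definition conditionC (R : realType) (d : nat)
    (P : probability (env R d) R) : Prop :=
  [/\ ergodic P,
      (forall n : int,
         (\int[P]_w lne ((1 - row_norm (Rmx w n + Pmx w n))%:E^-1) < +oo)%E /\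
         (\int[P]_w lne ((1 - row_norm (Rmx w n + Qmx w n))%:E^-1) < +oo)%E),
      {ae P, forall w, forall (j : 'I_d.+1) (n : int),
         0 < \sum_i Qmx w n i j /\ 0 < \sum_i Pmx w n i j} &
      (0 < P [set w | layer_communicates w 0])%E].

Definition trajectory_seq (d : nat) : Type := nat -> state d.

HB.instance Definition _ (d : nat) := Pointed.on (trajectory_seq d).

Definition trajectory_cylinders (d : nat) : set (set (trajectory_seq d)) :=
  [set C | exists (t : nat) (x : state d), C = [set X | X t = x]].

Definition trajectory (d : nat) :=
  g_sigma_algebraType (@trajectory_cylinders d).

(* The families (mu_w) of probability row vectors; measurability in w is what
   makes the annealed law below well defined. *)
Definition initial_family (R : realType) (d : nat)
    (mu : env R d -> 'rV[R]_d.+1) : Prop :=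
  (forall w, stochastic_mx (mu w)) /\
  (forall i, measurable_fun [set: env R d] (fun w => mu w 0 i)).

Definition initial_prob (R : realType) (d : nat) (nu : 'rV[R]_d.+1)
    (x : state d) : R :=
  if x.1 == 0 then nu 0 x.2 else 0.

(* K is the law of the Markov chain in the environment w with xi_0 = 0 and
   Y_0 ~ nu: finite-dimensional distributions determine it uniquely. *)
Definition quenched_law (R : realType) (d : nat) (w : env R d)
    (nu : 'rV[R]_d.+1) (K : probability (trajectory d) R) : Prop :=
  forall (t : nat) (x : nat -> state d),
    K [set X | forall s, (s <= t)%N -> X s = x s] =
    (initial_prob nu (x 0%N) * \prod_(s < t) transition w (x s) (x s.+1))%:E.

Definition annealed_law (R : realType) (d : nat)
    (P : probability (env R d) R)
    (Pq : env R d -> probability (trajectory d) R)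
    (Pa : probability (env R d * trajectory d)%type R) : Prop :=
  forall (F : set (env R d)) (G : set (trajectory d)),
    measurable F -> measurable G ->
    Pa (F `*` G) = (\int[P]_(w in F) Pq w G)%E.

Definition transient_right (R : realType) (d : nat)
    (Pa : probability (env R d * trajectory d)%type R) : Prop :=
  {ae Pa, forall z, ((z.2 t).1%:~R : R) @[t --> \oo] --> +oo}.

Definition hitting_time (R : realType) (d : nat) (n : int)
    (X : trajectory d) : \bar R :=
  ereal_inf [set t%:R%:E | t in [set t : nat | layer n (X t)]].

Definition is_zeta (R : realType) (d : nat) (P : probability (env R d) R)
    (zeta : env R d -> int -> 'M[R]_d.+1) : Prop :=
  {ae P, forall w, forall n : int,
     stochastic_mx (zeta w n) /\
     zeta w n =
       invmx (1%:M - Qmx w n *m zeta w (n - 1) - Rmx w n) *m Pmx w n}.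

Definition Amx (R : realType) (d : nat)
    (zeta : env R d -> int -> 'M[R]_d.+1) (w : env R d) (n : int) :
    'M[R]_d.+1 :=
  invmx (1%:M - Qmx w n *m zeta w (n - 1) - Rmx w n) *m Qmx w n.

Definition uvec (R : realType) (d : nat)
    (zeta : env R d -> int -> 'M[R]_d.+1) (w : env R d) (n : int) :
    'cV[R]_d.+1 :=
  invmx (1%:M - Qmx w n *m zeta w (n - 1) - Rmx w n) *m const_mx 1.

(* A_0 A_{-1} ... A_{-(k-1)} u_{-k} *)
Definition series_term (R : realType) (d : nat)
    (zeta : env R d -> int -> 'M[R]_d.+1) (w : env R d) (k : nat) :
    'cV[R]_d.+1 :=
  \big[mulmx/1%:M]_(0 <= l < k) Amx zeta w (- l%:Z) *m uvec zeta w (- k%:Z).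

(* Main.v *)
Require Import Defs.
From mathcomp Require Import all_boot all_order all_algebra.
From mathcomp Require Import all_classical all_reals all_analysis.
From mathcomp Require Import measurable_realfun.
From mathcomp Require Import ring lra.

(** The identity holds environment by environment: for almost every environment
[w], the quenched mean of [T_1] is [mu_w (u_0 + A_0 u_{-1} + ...)]. Write [S_t(m)]
for the vector of probabilities that the walk started in layer [-m] has stayed in
the layers [<= 0] up to time [t] ([survival]), so that the quenched mean of [T_1]
is the sum over [t] of [mu_w S_t(0)].

The partial sums [G_n = S_0 + ... + S_{n-1}] ([occupation]) satisfy
[G_{n+1} = 1 + L G_n], where [L] is the one-step operator of the walk killed when
it enters layer 1. They are compared with an explicit solution of the stationary
equation. Fix [k] and let [v_m] be the series [u + A u + A A u + ...] started at
layer [-m] and cut off below layer [-k]; define [h_0 = v_0] and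
[h_{m+1} = v_{m+1} + zeta_{-(m+1)} h_m] ([exit_time]). Heuristically [v_m] is the
expected time spent in the layers [>= -k] before going up from layer [-m] to the
next one, [zeta] is the law of the place of arrival, and [h_m] is the expected time
spent in the layers [>= -k] before reaching layer 1. What is proved is only the
algebraic counterpart [exit_timeE]: the equations for [zeta], [A] and [u] give
[h = 1_{m <= k} + L h]. Two inductions on [n] then give
  - [G_n(0) <= h_0] when [n <= k + 1], since in [n] steps the walk does not feel the
    cut-off ([occupation_le_exit_time]);
  - [h_0 <= G_n(0) + M S_n(0)] for all [n], where [M] bounds [h]
    ([exit_time_le_occupation]). Such an [M] exists, because [v_m = 0] for [m > k]
    and [zeta] is stochastic ([exit_time_bounded]).
As [h_0] is the sum of the first [k + 1] terms of the series in the theorem, and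
[mu_w S_n(0) -> 0] when the walk reaches layer 1 almost surely, letting [n] and then
[k] tend to infinity proves the quenched identity, including the case where both
sides are infinite ([quenched_exit_time]).

Almost sure arrival in layer 1 comes from transience to the right: a walk that
stays in the layers [<= 0] does not tend to [+oo] ([transient_no_trap]). The
integrability of the logarithm of [(1 - ||R_n + Q_n||)^{-1}] enters through
[ae_site_substochastic]: the rows of [R_n + Q_n] have sums [< 1], hence
[I - Q_n zeta_{n-1} - R_n] is invertible with a non-negative inverse. Finally, the
right-hand side is a function of [w] that need not be measurable, because [zeta]
is only constrained almost everywhere; [integral_ae_nonmeas] deals with this. *)

Set Implicit Arguments.
Unset Strict Implicit.
Unset Printing Implicit Defensive.

Import Order.TTheory GRing.Theory Num.Theory.
Import numFieldNormedType.Exports.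

Local Open Scope classical_set_scope.
Local Open Scope ring_scope.

(** * Entrywise order on matrices and resolvents of substochastic matrices *)

Definition lemx {R : realType} {m n : nat} (A B : 'M[R]_(m, n)) : Prop :=
  forall i j, A i j <= B i j.

Lemma nonneg_mxP (R : realType) (m n : nat) (A : 'M[R]_(m, n)) :
  reflect (lemx 0 A) (nonneg_mx A).
Proof.
apply: (iffP idP) => [/forallP h i j|h].
  by have /forallP/(_ j) := h i; rewrite mxE.
by apply/forallP => i; apply/forallP => j; have := h i j; rewrite mxE.
Qed.

Lemma lemx_refl (R : realType) (m n : nat) (A : 'M[R]_(m, n)) : lemx A A.
Proof. by move=> i j. Qed.

Lemma lemx_trans (R : realType) (m n : nat) (B A C : 'M[R]_(m, n)) :
  lemx A B -> lemx B C -> lemx A C.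
Proof. by move=> h k i j; exact: le_trans (h i j) (k i j). Qed.

Lemma lemxD (R : realType) (m n : nat) (A B A' B' : 'M[R]_(m, n)) :
  lemx A A' -> lemx B B' -> lemx (A + B) (A' + B').
Proof. by move=> h k i j; rewrite !mxE lerD. Qed.

Lemma addmx_ge0 (R : realType) (m n : nat) (A B : 'M[R]_(m, n)) :
  lemx 0 A -> lemx 0 B -> lemx 0 (A + B).
Proof. by move=> A0 B0; rewrite -(addr0 0); exact: lemxD. Qed.

Lemma lemx_mul2l (R : realType) (m n p : nat) (A : 'M[R]_(m, n))
    (B B' : 'M[R]_(n, p)) :
  lemx 0 A -> lemx B B' -> lemx (A *m B) (A *m B').
Proof.
move=> A0 BB' i j; rewrite !mxE; apply: ler_sum => k _.
by apply: ler_wpM2l => //; have := A0 i k; rewrite mxE.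
Qed.

Lemma mulmx_ge0 (R : realType) (m n p : nat) (A : 'M[R]_(m, n))
    (B : 'M[R]_(n, p)) :
  lemx 0 A -> lemx 0 B -> lemx 0 (A *m B).
Proof. by move=> A0 B0; rewrite -(mulmx0 p A); exact: lemx_mul2l. Qed.

Lemma stochastic_mxP (R : realType) (m n : nat) (A : 'M[R]_(m, n)) :
  stochastic_mx A -> lemx 0 A /\ A *m const_mx 1 = const_mx 1 :> 'cV_m.
Proof.
case/andP => /nonneg_mxP A0 /forallP A1; split=> //.
apply/matrixP => i j; rewrite mxE [RHS]mxE; apply: etrans (eqP (A1 i)).
by apply: eq_bigr => k _; rewrite mxE mulr1.
Qed.

Lemma row_norm_ge (R : realType) (m n : nat) (A : 'M[R]_(m, n)) (i : 'I_m) :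
  \sum_j A i j <= row_norm A.
Proof.
apply: le_trans (le_bigmax_cond _ (fun i => \sum_j `|A i j|) _) => //.
by apply: ler_sum => j _; exact: ler_norm.
Qed.

(** At a row where [x] is minimal, [x] dominates its [B]-average, which is at least
the row sum of [B], a number [< 1], times that minimum; so the minimum is [>= 0]. *)
Lemma max_principle (R : realType) (n : nat) (B : 'M[R]_n) (x : 'cV[R]_n) :
  lemx 0 B -> (forall i, \sum_j B i j < 1) ->
  lemx 0 ((1%:M - B) *m x) -> lemx 0 x.
Proof.
case: n B x => [|n] B x B0 B1 hx; first by case.
set i0 := [arg min_(i < ord0) x i 0]%O.
have xmin j : x i0 0 <= x j 0 by rewrite /i0; case: arg_minP => // i _; exact.
suff x0 : 0 <= x i0 0 by move=> i j; rewrite mxE ord1 (le_trans x0).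
have := hx i0 0; rewrite mulmxBl mul1mx !mxE subr_ge0 => h.
have : (\sum_j B i0 j) * x i0 0 <= x i0 0.
  apply: le_trans h; rewrite mulr_suml; apply: ler_sum => j _.
  by apply: ler_wpM2l => //; have := B0 i0 j; rewrite mxE.
have := B1 i0; move: (\sum_j _) (x i0 0) => s y s1 hs.
by rewrite leNgt; apply/negP => y0; nra.
Qed.

(** The maximum principle applied to a kernel vector and to its opposite. *)
Lemma resolvent_unitmx (R : realType) (n : nat) (B : 'M[R]_n) :
  lemx 0 B -> (forall i, \sum_j B i j < 1) -> 1%:M - B \in unitmx.
Proof.
move=> B0 B1; rewrite -unitmx_tr -row_free_unit -kermx_eq0.
apply/eqP/row_matrixP => i; rewrite row0.
set r := row i _; have hr : (1%:M - B) *m r^T = 0.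
  apply: trmx_inj; rewrite trmx_mul trmxK trmx0.
  by rewrite /r -row_mul mulmx_ker row0.
apply: trmx_inj; rewrite trmx0; apply/matrixP => k l.
apply: le_anti; apply/andP; split; last first.
  by apply: (@max_principle _ _ B) k l => //; rewrite hr; exact: lemx_refl.
have : lemx 0 (- r^T).
  by apply: (@max_principle _ _ B) => //; rewrite mulmxN hr oppr0; exact: lemx_refl.
by move=> /(_ k l); rewrite !mxE oppr_ge0.
Qed.

(** Columnwise, this is the maximum principle applied to the solution of
[(1 - B) x = y]. *)
Lemma resolvent_ge0 (R : realType) (n p : nat) (B : 'M[R]_n) (Y : 'M[R]_(n, p)) :
  lemx 0 B -> (forall i, \sum_j B i j < 1) -> lemx 0 Y ->
  lemx 0 (invmx (1%:M - B) *m Y).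
Proof.
move=> B0 B1 Y0 i j.
have : lemx 0 (col j (invmx (1%:M - B) *m Y)).
  apply: (@max_principle _ _ B) => //.
  rewrite colE -mulmxA (mulmxA (_ - _)) mulmxV ?resolvent_unitmx// mul1mx -colE.
  by move=> k l; have := Y0 k j; rewrite !mxE.
by move=> /(_ i 0); rewrite !mxE.
Qed.

(** * Deterministic comparison in a fixed environment *)

(** What is needed of an environment and of a solution [z] of the fixed-point
equation; it holds almost surely. *)
Definition ladder_env {R : realType} {d : nat} (w : env R d)
    (z : int -> 'M[R]_d.+1) : Prop :=
  forall n : int,
    [/\ stochastic_mx (z n),
        z n = invmx (1%:M - Qmx w n *m z (n - 1) - Rmx w n) *m Pmx w n
      & forall i, \sum_j (Rmx w n + Qmx w n) i j < 1].

Lemma site_ge0 (R : realType) (d : nat) (w : env R d) (n : int) :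
  [/\ lemx 0 (Pmx w n), lemx 0 (Qmx w n), lemx 0 (Rmx w n) &
      (Pmx w n + Qmx w n + Rmx w n) *m const_mx 1 = const_mx 1 :> 'cV_d.+1].
Proof.
rewrite /Pmx /Qmx /Rmx; case: (w n) => -[[p q] r] /=.
move=> /and4P[/= p0 q0 r0 /stochastic_mxP[_ h]].
by split=> //; exact/nonneg_mxP.
Qed.

(** The kernel of the walk observed at its successive visits to layer [n], before
it reaches layer [n + 1]: an excursion to layer [n - 1] returns according to
[z (n - 1)]. Its resolvent produces [zeta], [A] and [u]. *)
Definition ladder_mx {R : realType} {d : nat} (w : env R d)
    (z : int -> 'M[R]_d.+1) (n : int) : 'M[R]_d.+1 :=
  Qmx w n *m z (n - 1) + Rmx w n.

Lemma ladder_mx_ge0 (R : realType) (d : nat) (w : env R d)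
    (z : int -> 'M[R]_d.+1) (n : int) :
  ladder_env w z -> lemx 0 (ladder_mx w z n).
Proof.
move=> hz; have [_ q0 r0 _] := site_ge0 w n.
have [/stochastic_mxP[z0 _] _ _] := hz (n - 1).
by apply: addmx_ge0 => //; exact: mulmx_ge0.
Qed.

(** As [z (n - 1)] is stochastic, [Q z + R] has the same row sums as [Q + R]. *)
Lemma ladder_mx_lt1 (R : realType) (d : nat) (w : env R d)
    (z : int -> 'M[R]_d.+1) (n : int) (i : 'I_d.+1) :
  ladder_env w z -> \sum_j ladder_mx w z n i j < 1.
Proof.
move=> hz; have [_ _ rq1] := hz n.
have [/stochastic_mxP[_ z1] _ _] := hz (n - 1).
apply: le_lt_trans (rq1 i).
have sumE (A : 'M[R]_d.+1) : \sum_j A i j = (A *m const_mx 1 : 'cV_d.+1) i 0.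
  by rewrite mxE; apply: eq_bigr => j _; rewrite mxE mulr1.
by rewrite !sumE /ladder_mx mulmxDl -mulmxA z1 -mulmxDl addrC.
Qed.

(** The only two facts about the inverse used below; taking [Y] to be [P_n], [Q_n]
and [1] covers [zeta_n], [A_n] and [u_n]. *)
Lemma ladder_resolventP (R : realType) (d p : nat) (w : env R d)
    (z : int -> 'M[R]_d.+1) (n : int) (Y : 'M[R]_(d.+1, p)) :
  ladder_env w z ->
  let X := invmx (1%:M - Qmx w n *m z (n - 1) - Rmx w n) *m Y in
  X = Y + ladder_mx w z n *m X /\ (lemx 0 Y -> lemx 0 X).
Proof.
move=> hz; rewrite -addrA -opprD -/(ladder_mx w z n) /=; split; last first.
  move=> Y0; apply: resolvent_ge0 => //; first exact: ladder_mx_ge0.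
  by move=> i; exact: ladder_mx_lt1.
set B := ladder_mx w z n; apply/eqP; rewrite -subr_eq -{1}[_ *m Y]mul1mx -mulmxBl.
rewrite mulmxA mulmxV ?mul1mx//; apply: resolvent_unitmx.
  exact: ladder_mx_ge0.
by move=> i; exact: ladder_mx_lt1.
Qed.

(** The first [r] terms of [u_n + A_n u_{n-1} + A_n A_{n-1} u_{n-2} + ...], in Horner
form: the form on which one can do a first-step analysis. *)
Fixpoint partial_time {R : realType} {d : nat} (zeta : env R d -> int -> 'M[R]_d.+1)
    (w : env R d) (r : nat) (n : int) : 'cV[R]_d.+1 :=
  if r is r'.+1 then
    uvec zeta w n + Amx zeta w n *m partial_time zeta w r' (n - 1)
  else 0.

Lemma partial_timeS (R : realType) (d : nat) (zeta : env R d -> int -> 'M[R]_d.+1)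
    (w : env R d) (r : nat) (n : int) :
  ladder_env w (zeta w) ->
  partial_time zeta w r.+1 n =
    const_mx 1 + Qmx w n *m partial_time zeta w r (n - 1)
    + ladder_mx w (zeta w) n *m partial_time zeta w r.+1 n.
Proof.
move=> hz /=; rewrite /uvec /Amx -mulmxA -mulmxDr.
set Y := (_ + Qmx w n *m _); have [+ _] := ladder_resolventP n Y hz.
exact.
Qed.

Lemma partial_time_ge0 (R : realType) (d : nat)
    (zeta : env R d -> int -> 'M[R]_d.+1) (w : env R d) (r : nat) (n : int) :
  ladder_env w (zeta w) -> lemx 0 (partial_time zeta w r n).
Proof.
move=> hz; elim: r n => [|r IH] n; first exact: lemx_refl.
rewrite /= /uvec /Amx -mulmxA -mulmxDr.
have [_] := ladder_resolventP n
  (const_mx 1 + Qmx w n *m partial_time zeta w r (n - 1)) hz.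
apply; apply: addmx_ge0.
  by move=> i j; rewrite !mxE.
by have [_ q0 _ _] := site_ge0 w n; exact: mulmx_ge0.
Qed.

Lemma partial_time_series (R : realType) (d : nat)
    (zeta : env R d -> int -> 'M[R]_d.+1) (w : env R d) (r : nat) :
  partial_time zeta w r 0 = \sum_(0 <= k < r) series_term zeta w k.
Proof.
suff E n : partial_time zeta w r n = \sum_(0 <= k < r)
    (\big[mulmx/1%:M]_(0 <= l < k) Amx zeta w (n - l%:Z) *m uvec zeta w (n - k%:Z)).
  by rewrite E; apply: eq_bigr => k _; rewrite /series_term sub0r; congr (_ *m _);
     apply: eq_bigr => l _; rewrite sub0r.
elim: r n => [|r IH] n; first by rewrite big_geq.
rewrite big_nat_recl//= big_geq// mul1mx subr0; congr (_ + _).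
rewrite IH mulmx_sumr; apply: eq_bigr => k _.
have sE (l : nat) : n - l.+1%:Z = n - 1 - l%:Z by rewrite -addn1 PoszD; ring.
rewrite big_nat_recl// mulmxA subr0 sE; congr (_ *m _ *m _).
by apply: eq_bigr => l _; rewrite sE.
Qed.

(** One step of the walk killed on entering layer 1, acting on functions on the
layers [<= 0]; layer [-m] is coded by [m : nat], so that induction on the number of
layers below layer 1 is available. *)
Definition killed_step {R : realType} {d : nat} (w : env R d)
    (f : nat -> 'cV[R]_d.+1) (m : nat) : 'cV[R]_d.+1 :=
  Pmx w (- m%:Z) *m (if m is m'.+1 then f m' else 0)
  + Rmx w (- m%:Z) *m f m + Qmx w (- m%:Z) *m f m.+1.

Lemma killed_step_le (R : realType) (d : nat) (w : env R d)
    (f g : nat -> 'cV[R]_d.+1) (m : nat) :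
  (forall l, (l <= m.+1)%N -> lemx (f l) (g l)) ->
  lemx (killed_step w f m) (killed_step w g m).
Proof.
move=> fg; have [p0 q0 r0 _] := site_ge0 w (- m%:Z).
apply: lemxD; [apply: lemxD|]; apply: lemx_mul2l => //; try exact: fg.
by case: m {p0 q0 r0} fg => [_|m fg]; [exact: lemx_refl|apply: fg; do 2!apply: leqW].
Qed.

Lemma killed_step_comb (R : realType) (d : nat) (w : env R d)
    (f g : nat -> 'cV[R]_d.+1) (c : R) (m : nat) :
  killed_step w (fun l => f l + c *: g l) m =
  killed_step w f m + c *: killed_step w g m.
Proof.
rewrite /killed_step !scalerDr !mulmxDr -!scalemxAr.
case: m => [|m]; rewrite ?mulmx0 ?scaler0 ?mulmxDr -?scalemxAr.
  by rewrite !add0r addrACA.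
by rewrite [X in X + _ = _]addrACA [LHS]addrACA.
Qed.

Definition survival {R : realType} {d : nat} (w : env R d) (t m : nat) :
    'cV[R]_d.+1 :=
  iter t (killed_step w) (fun=> const_mx 1) m.

Definition occupation {R : realType} {d : nat} (w : env R d) (t m : nat) :
    'cV[R]_d.+1 :=
  \sum_(0 <= s < t) survival w s m.

Lemma occupation_recr (R : realType) (d : nat) (w : env R d) (t : nat) :
  occupation w t.+1 = fun m => occupation w t m + 1 *: survival w t m.
Proof. by apply/funext => m; rewrite /occupation big_nat_recr//= scale1r. Qed.

(** Splitting off the first step, whereas [occupation] adds the last one. *)
Lemma occupationS (R : realType) (d : nat) (w : env R d) (t m : nat) :
  occupation w t.+1 m = const_mx 1 + killed_step w (occupation w t) m.
Proof.
elim: t m => [|t IH] m.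
  have -> : occupation w 0 = fun=> 0.
    by apply/funext => l; rewrite /occupation big_geq.
  rewrite /occupation big_nat1 /killed_step.
  by case: m => [|m]; rewrite !mulmx0 !addr0.
by rewrite occupation_recr IH occupation_recr killed_step_comb !scale1r -addrA.
Qed.

(** Candidate for the expected time spent in the layers [>= -k] before layer 1 is
reached from layer [-m]: the time needed to climb one layer, then the remaining
time from the random place of arrival. The truncated subtraction makes the first
term vanish for [m > k], as it should. *)
Fixpoint exit_time {R : realType} {d : nat} (zeta : env R d -> int -> 'M[R]_d.+1)
    (w : env R d) (k m : nat) : 'cV[R]_d.+1 :=
  partial_time zeta w (k.+1 - m) (- m%:Z) +
  if m is m'.+1 then zeta w (- m%:Z) *m exit_time zeta w k m' else 0.

Lemma exit_time0 (R : realType) (d : nat)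
    (zeta : env R d -> int -> 'M[R]_d.+1) (w : env R d) (k : nat) :
  exit_time zeta w k 0 = partial_time zeta w k.+1 0.
Proof. by rewrite /= addr0 oppr0. Qed.

Lemma exit_timeS (R : realType) (d : nat)
    (zeta : env R d -> int -> 'M[R]_d.+1) (w : env R d) (k m : nat) :
  exit_time zeta w k m.+1 = partial_time zeta w (k.+1 - m.+1) (- m.+1%:Z)
    + zeta w (- m.+1%:Z) *m exit_time zeta w k m.
Proof. by []. Qed.

Lemma exit_time_ge0 (R : realType) (d : nat)
    (zeta : env R d -> int -> 'M[R]_d.+1) (w : env R d) (k m : nat) :
  ladder_env w (zeta w) -> lemx 0 (exit_time zeta w k m).
Proof.
move=> hz; elim: m => [|m IH]; rewrite ?exit_time0 ?exit_timeS.
  exact: partial_time_ge0.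
apply: addmx_ge0; first exact: partial_time_ge0.
have [/stochastic_mxP[z0 _] _ _] := hz (- m.+1%:Z).
exact: mulmx_ge0.
Qed.

(** The key identity. The resolvent equations read
[zeta_n = P + (Q zeta_{n-1} + R) zeta_n] and
[v_m = 1_{m <= k} + Q v_{m+1} + (Q zeta_{n-1} + R) v_m]. Inserting them into
[h_m = v_m + zeta_n h_{m-1}] and using [h_{m+1} = v_{m+1} + zeta_{n-1} h_m] to fold
[Q v_{m+1} + Q zeta_{n-1} h_m] into [Q h_{m+1}] gives the first-step equation. *)
Lemma exit_timeE (R : realType) (d : nat)
    (zeta : env R d -> int -> 'M[R]_d.+1) (w : env R d) (k m : nat) :
  ladder_env w (zeta w) ->
  exit_time zeta w k m =
    (if (m <= k)%N then const_mx 1 else 0) + killed_step w (exit_time zeta w k) m.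
Proof.
move=> hz; set n := - m%:Z.
set v := fun l : nat => partial_time zeta w (k.+1 - l) (- l%:Z).
set h := exit_time zeta w k.
have nS : - m.+1%:Z = n - 1 by rewrite /n -addn1 PoszD opprD.
have hS : h m.+1 = v m.+1 + zeta w (n - 1) *m h m by rewrite -nS.
set f := if m is m'.+1 then h m' else 0.
have hm : h m = v m + zeta w n *m f.
  by rewrite /h /f /v /n; case: m {nS hS f n} => //=; rewrite mulmx0.
have [_ zE _] := hz n.
have zL : zeta w n = Pmx w n + ladder_mx w (zeta w) n *m zeta w n.
  by rewrite {1 2}zE; have [+ _] := ladder_resolventP n (Pmx w n) hz.
have vL : v m = (if (m <= k)%N then const_mx 1 else 0) + Qmx w n *m v m.+1
    + ladder_mx w (zeta w) n *m v m.
  rewrite /v; case: leqP => mk.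
    by rewrite subSn// subSS nS; exact: partial_timeS.
  have -> : (k.+1 - m = 0)%N by apply/eqP; rewrite subn_eq0.
  have -> : (k.+1 - m.+1 = 0)%N by apply/eqP; rewrite subn_eq0 ltnW.
  by rewrite !mulmx0 !addr0.
rewrite /killed_step -/n -/f hS.
have hE : h m = Pmx w n *m f + ((if (m <= k)%N then const_mx 1 else 0) +
    Qmx w n *m v m.+1) + ladder_mx w (zeta w) n *m h m.
  move: zL vL; move: (ladder_mx w (zeta w) n) => L zL vL.
  rewrite {1}hm {1}zL {1}vL hm mulmxDl mulmxDr -mulmxA addrACA.
  by congr (_ + _); rewrite addrC.
rewrite {1}hE [ladder_mx _ _ _]/ladder_mx mulmxDl mulmxDr !mulmxA.
move: (if _ then _ else _) (Pmx w n *m f) (Qmx w n *m v m.+1) (_ *m h m) (_ *m h m).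
move=> a b c e g; rewrite (addrCA b) -addrA; congr (_ + _).
by rewrite (addrC g) addrACA.
Qed.

(** Both sides satisfy the same first-step equation on the layers [>= -k], and within
[t] steps a walk started in layer [-m] stays among them, its final position
excepted, when [m + t <= k + 1]. *)
Lemma occupation_le_exit_time (R : realType) (d : nat)
    (zeta : env R d -> int -> 'M[R]_d.+1) (w : env R d) (k t m : nat) :
  ladder_env w (zeta w) -> (m + t <= k.+1)%N ->
  lemx (occupation w t m) (exit_time zeta w k m).
Proof.
move=> hz; elim: t m => [|t IH] m mt.
  by rewrite /occupation big_geq//; exact: exit_time_ge0.
rewrite occupationS exit_timeE//.
have -> : (m <= k)%N.
  by rewrite -ltnS; apply: leq_trans mt; rewrite addnS ltnS leq_addr.
apply: lemxD; first exact: lemx_refl.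
apply: killed_step_le => l lm; apply: IH.
by apply: leq_trans mt; rewrite addnS -addSn leq_add2r.
Qed.

(** Below layer [-k] no time is counted, so there [exit_time] is only averaged by the
stochastic matrices [zeta]. *)
Lemma exit_time_bounded (R : realType) (d : nat)
    (zeta : env R d -> int -> 'M[R]_d.+1) (w : env R d) (k : nat) :
  ladder_env w (zeta w) ->
  exists M, forall m, lemx (exit_time zeta w k m) (M *: const_mx 1).
Proof.
move=> hz.
pose c l := \sum_i partial_time zeta w (k.+1 - l) (- l%:Z) i 0.
have v0 l i : 0 <= partial_time zeta w (k.+1 - l) (- l%:Z) i 0.
  by have := partial_time_ge0 (k.+1 - l) (- l%:Z) hz i 0; rewrite mxE.
have c0 l : 0 <= c l by apply: sumr_ge0.
have vc l : lemx (partial_time zeta w (k.+1 - l) (- l%:Z)) (c l *: const_mx 1).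
  move=> i j; rewrite !mxE mulr1 ord1 /c (bigD1 i)//= lerDl.
  exact: sumr_ge0.
have hsum m : lemx (exit_time zeta w k m) ((\sum_(0 <= l < m.+1) c l) *: const_mx 1).
  elim: m => [|m IH]; first by rewrite big_nat1 exit_time0; exact: (vc 0%N).
  rewrite big_nat_recr// scalerDl addrC exit_timeS.
  apply: lemxD; first exact: vc.
  have [/stochastic_mxP[z0 z1] _ _] := hz (- m.+1%:Z).
  by apply: (lemx_trans (lemx_mul2l z0 IH)); rewrite -scalemxAr z1; exact: lemx_refl.
exists (\sum_(0 <= l < k.+1) c l).
move=> m; apply: (lemx_trans (hsum m)) => i j; rewrite !mxE !mulr1.
case: (leqP m k) => mk.
  by rewrite [leRHS](big_cat_nat _ (n := m.+1))//= lerDl; apply: sumr_ge0.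
rewrite [leLHS](big_cat_nat _ (n := k.+1))//=; last by rewrite ltnW.
rewrite -[leRHS]addr0 lerD2l big_nat big1// => l /andP[kl _].
have /eqP kl0 : (k.+1 - l == 0)%N by rewrite subn_eq0.
by rewrite /c kl0 big1// => i' _; rewrite mxE.
Qed.

(** Optional stopping at time [t]: until then at most [occupation w t m] has been
accumulated, and the walks that are still alive contribute at most [M] each. *)
Lemma exit_time_le_occupation (R : realType) (d : nat)
    (zeta : env R d -> int -> 'M[R]_d.+1) (w : env R d) (k : nat) (M : R) :
  ladder_env w (zeta w) ->
  (forall m, lemx (exit_time zeta w k m) (M *: const_mx 1)) ->
  forall t m, lemx (exit_time zeta w k m) (occupation w t m + M *: survival w t m).
Proof.
move=> hz hM; elim=> [|t IH] m.
  by rewrite /occupation big_geq// add0r; exact: hM.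
rewrite occupationS exit_timeE// -addrA -killed_step_comb.
apply: lemxD; last by apply: killed_step_le => l _; exact: IH.
by case: ifP => _ i j; rewrite ?lexx// !mxE.
Qed.

Lemma series_term_ge0 (R : realType) (d : nat)
    (zeta : env R d -> int -> 'M[R]_d.+1) (w : env R d) (k : nat) :
  ladder_env w (zeta w) -> lemx 0 (series_term zeta w k).
Proof.
move=> hz; apply: mulmx_ge0.
  apply: (big_ind (fun M : 'M[R]_d.+1 => lemx 0 M)).
  - by move=> i j; rewrite !mxE ler0n.
  - by move=> A B; exact: mulmx_ge0.
  - move=> l _; have [_] := ladder_resolventP (- l%:Z) (Qmx w (- l%:Z)) hz.
    by apply; have [_ + _ _] := site_ge0 w (- l%:Z).
have [_] := ladder_resolventP (- k%:Z) (const_mx 1 : 'cV_d.+1) hz.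
by apply=> i j; rewrite !mxE.
Qed.

Lemma survival_ge0 (R : realType) (d : nat) (w : env R d) (t m : nat) :
  lemx 0 (survival w t m).
Proof.
elim: t m => [|t IH] m; first by move=> i j; rewrite !mxE.
have -> : 0 = killed_step w (fun=> 0) m.
  by rewrite /killed_step; case: m => [|m]; rewrite !mulmx0 !addr0.
by apply: killed_step_le => l _; exact: IH.
Qed.

(** * Staying probabilities under the quenched law *)

(** The part of [C] outside the [F i] has measure zero, although it may be non-empty;
this is how trajectories with jumps longer than 1 are discarded. *)
Lemma measure_finType_split (d : measure_display) (T : measurableType d)
    (R : realType) (K : probability T R) (I : finType)
    (C E : set T) (F : I -> set T) :
  measurable C -> measurable E -> (forall i, measurable (F i)) ->
  trivIset setT F -> (forall i, F i `<=` C) -> (\sum_i K (F i) = K C)%E ->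
  (K (C `&` E) = \sum_i K (F i `&` E))%E.
Proof.
move=> mC mE mF tF FC FE.
have addK (G : I -> set T) : (forall i, measurable (G i)) -> trivIset setT G ->
    (K (\bigcup_i G i) = \sum_i K (G i))%E.
  move=> mG tG; rewrite measure_fin_bigcup//; last exact: finite_finset.
  rewrite (@fsbig_seq _ _ _ _ (index_enum I)) ?index_enum_uniq//.
  rewrite (_ : [set` index_enum I] = setT)//.
  by apply/seteqP; split=> i //= _; rewrite mem_index_enum.
have mU (G : I -> set T) : (forall i, measurable (G i)) ->
    measurable (\bigcup_i G i).
  by move=> mG; apply: fin_bigcup_measurable => //; exact: finite_finset.
have UC : \bigcup_i F i `<=` C by move=> x [i _ /FC].
have Kfin A : measurable A -> K A \is a fin_num.
  by move=> mA; exact: fin_num_measure.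
have KU : K (\bigcup_i F i) = K C by rewrite addK.
have D0 : K (C `\` \bigcup_i F i) = 0%E.
  have KD : K (C `\` \bigcup_i F i) = (K C - K (C `&` \bigcup_i F i))%E.
    by apply: measureD => //; [exact: mU|rewrite ltey_eq Kfin].
  by rewrite KD setIidr// KU subee// Kfin.
have KE : K (C `&` E) = (K (C `&` E `\` \bigcup_i F i) +
    K (C `&` E `&` \bigcup_i F i))%E.
  by apply: measureDI; [exact: measurableI|exact: mU].
have KN : K (C `&` E `\` \bigcup_i F i) = 0%E.
  apply: subset_measure0 D0; last by move=> x [[Cx _] Ux].
    by apply: measurableD; [exact: measurableI|exact: mU].
  by apply: measurableD => //; exact: mU.
rewrite KE KN add0e (_ : _ `&` _ = \bigcup_i (F i `&` E)).
  rewrite addK// => [i|i j _ _ [x [[Fi _] [Fj _]]]]; first exact: measurableI.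
  by apply: tF => //; exists x.
apply/seteqP; split=> [x [[_ Ex] [i _ Fi]]|x [i _ [Fi Ex]]]; first by exists i.
by split; [split => //; exact: FC Fi|exists i].
Qed.

Lemma measurable_coord (d t : nat) (A : set (state d)) :
  measurable [set X : trajectory d | A (X t)].
Proof.
have -> : [set X : trajectory d | A (X t)] =
    \bigcup_(x : (int * 'I_d.+1)%type)
      (if `[< A x >] then [set X : trajectory d | X t = x] else set0).
  apply/seteqP; split=> [X /= AX|X [x _]] /=.
    by exists (X t) => //=; rewrite asboolT.
  by case: asboolP => //= Ax ->.
apply: countable_bigcupT_measurable => [|x]; first exact: countableP.
case: ifP => _; last exact: measurable0.
by apply: sub_sigma_algebra; exists t, x.
Qed.

Definition stay_event (d : nat) (A : pred int) (t r : nat) : set (trajectory d) :=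
  [set X | forall s, (t <= s <= t + r)%N -> A (X s).1].

Lemma measurable_stay_event (d : nat) (A : pred int) (t r : nat) :
  measurable (@stay_event d A t r).
Proof.
rewrite (_ : stay_event A t r = \bigcap_(s in [set s | (t <= s <= t + r)%N])
    [set X : trajectory d | A (X s).1]).
  apply: bigcap_measurableType => s _.
  exact: (measurable_coord s [set x | A x.1]).
by apply/seteqP; split.
Qed.

Definition start_event (d : nat) (x : nat -> state d) (t : nat) :
    set (trajectory d) :=
  [set X | forall s, (s <= t)%N -> X s = x s].

Lemma measurable_start_event (d : nat) (x : nat -> state d) (t : nat) :
  measurable (start_event x t).
Proof.
rewrite (_ : start_event x t = \bigcap_(s in [set s | (s <= t)%N])
    [set X : trajectory d | X s = x s]).
  apply: bigcap_measurableType => s _.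
  exact: (measurable_coord s [set y | y = x s]).
by apply/seteqP; split.
Qed.

Definition walk_step (R : realType) (d : nat) (w : env R d)
    (f : int -> 'cV[R]_d.+1) (n : int) : 'cV[R]_d.+1 :=
  Pmx w n *m f (n + 1) + Rmx w n *m f n + Qmx w n *m f (n - 1).

(** The probability, as a function of the starting point in layer [n], of remaining in
the layers satisfying [A] up to time [t]. Two instances are needed: [n != 1], which
expresses [t < T_1], and [n <= 0], which is incompatible with transience. *)
Fixpoint stay (R : realType) (d : nat) (A : pred int) (w : env R d) (t : nat)
    (n : int) : 'cV[R]_d.+1 :=
  if A n then
    if t is t'.+1 then walk_step w (stay A w t') n else const_mx 1
  else 0.

(** The index 0, 1 or 2 stands for a jump by [+1], [0] or [-1]. *)
Definition neighbour (d : nat) (n : int) (y : 'I_3 * 'I_d.+1) : state d :=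
  (n + 1 - (y.1 : nat)%:Z, y.2).

Lemma neighbour_inj (d : nat) (n : int) : injective (@neighbour d n).
Proof.
move=> [a j] [b k] [] /addrI /oppr_inj [] ab ->.
by congr (_, _); exact: val_inj.
Qed.

Lemma transition_sum (R : realType) (d : nat) (w : env R d)
    (f : int -> 'cV[R]_d.+1) (x : state d) :
  \sum_y transition w x (neighbour x.1 y) *
    f (neighbour x.1 y).1 (neighbour x.1 y).2 0 = walk_step w f x.1 x.2 0.
Proof.
case: x => n i /=.
rewrite -(pair_bigA _ (fun a j => transition w (n, i) (neighbour n (a, j)) *
    f (n + 1 - (nat_of_ord a)%:Z) j 0)) /=.
rewrite (big_ord_recl 2) (big_ord_recl 1) (big_ord_recl 0) big_ord0 !addr0.
rewrite /transition /neighbour /= !mxE.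
rewrite -[in RHS]addrA; congr (_ + (_ + _)); apply: eq_bigr => j _.
- by rewrite subr0 eqxx.
- by rewrite (_ : n + 1 - _ = n) ?addrK// eqxx -subr_eq0 opprD addrA subrr.
- have -> : n + 1 - (bump 0 (bump 0 0))%:Z = n - 1 by rewrite /bump /=; ring.
  have -> : (n - 1 == n + 1) = false by apply/negP => /eqP; lra.
  have -> : (n - 1 == n) = false by apply/negP => /eqP; lra.
  by rewrite eqxx.
Qed.

Lemma transition_sum1 (R : realType) (d : nat) (w : env R d) (x : state d) :
  \sum_y transition w x (neighbour x.1 y) = 1.
Proof.
transitivity (walk_step w (fun=> const_mx 1) x.1 x.2 0).
  by rewrite -transition_sum; apply: eq_bigr => y _; rewrite mxE mulr1.
have [_ _ _ h] := site_ge0 w x.1.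
have := congr1 (fun M : 'cV_d.+1 => M x.2 0) h.
by rewrite /walk_step !mulmxDl addrAC => ->; rewrite mxE.
Qed.

(** Markov property at time [t]; the induction on [r] conditions on the position at
time [t + 1]. *)
Lemma quenched_stay_from (R : realType) (d : nat) (A : pred int) (w : env R d)
    (nu : 'rV[R]_d.+1) (K : probability (trajectory d) R) (r t : nat)
    (x : nat -> state d) :
  quenched_law w nu K ->
  K (start_event x t `&` stay_event A t r) =
  (initial_prob nu (x 0%N) * \prod_(s < t) transition w (x s) (x s.+1)
   * stay A w r (x t).1 (x t).2 0)%:E.
Proof.
move=> hK; elim: r t x => [|r IH] t x; rewrite [stay _ _ _ _]/=; case: ifP => Ax.
- rewrite mxE mulr1 -hK; congr (K _); apply/seteqP; split=> [X []//|X hX].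
  split=> // s; rewrite addn0 -eqn_leq => /eqP <-.
  by rewrite hX.
- rewrite mxE mulr0 (_ : _ `&` _ = set0) ?measure0//.
  apply/seteqP; split=> // X [hX hA].
  by have := hA t; rewrite leqnn addn0 leqnn hX// Ax => /(_ isT).
(* The prescribed path [x], continued after time [t] by the neighbour [y]. *)
- pose x' y s := if (s <= t)%N then x s else neighbour (x t).1 y.
  have x'E y s : (s <= t)%N -> x' y s = x s by rewrite /x' => ->.
  have x't y : x' y t.+1 = neighbour (x t).1 y by rewrite /x' ltnn.
  have prodE y : initial_prob nu (x' y 0%N) *
      \prod_(s < t.+1) transition w (x' y s) (x' y s.+1) =
      initial_prob nu (x 0%N) * \prod_(s < t) transition w (x s) (x s.+1) *
      transition w (x t) (neighbour (x t).1 y).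
    rewrite x'E// big_ord_recr /= mulrA x't x'E//; congr (_ * _ * _).
    by apply: eq_bigr => s _; rewrite !x'E// ltnW.
  have -> : start_event x t `&` stay_event A t r.+1 =
      start_event x t `&` stay_event A t.+1 r.
    apply/seteqP; split=> X [hX hA]; split=> // s /andP[ts sr].
      by apply: hA; rewrite (ltnW ts) -addSnnS.
    move: ts; rewrite leq_eqVlt => /predU1P[<-|ts]; first by rewrite hX.
    by apply: hA; rewrite ts addSnnS.
  rewrite (@measure_finType_split _ _ _ K _ _ _ (fun y => start_event (x' y) t.+1)).
  + rewrite -transition_sum mulr_sumr -sumEFin; apply: eq_bigr => y _.
    by rewrite IH prodE x't mulrA.
  + exact: measurable_start_event.
  + exact: measurable_stay_event.
  + by move=> y; exact: measurable_start_event.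
  + move=> y y' _ _ [X [hX hX']]; apply: (@neighbour_inj _ (x t).1).
    by rewrite -!x't -hX// -hX'.
  + by move=> y X hX s st; rewrite hX ?x'E// leqW.
  + rewrite [RHS]hK; under eq_bigr do rewrite [K _]hK prodE.
    by rewrite sumEFin -mulr_sumr transition_sum1 mulr1.
- rewrite mxE mulr0 (_ : _ `&` _ = set0) ?measure0//.
  apply/seteqP; split=> // X [hX hA].
  by have := hA t; rewrite leqnn leq_addr hX// Ax => /(_ isT).
Qed.

Lemma quenched_stay (R : realType) (d : nat) (A : pred int) (w : env R d)
    (nu : 'rV[R]_d.+1) (K : probability (trajectory d) R) (t : nat) :
  quenched_law w nu K -> stochastic_mx nu ->
  K (stay_event A 0 t) = (\sum_i nu 0 i * stay A w t 0 i 0)%:E.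
Proof.
move=> hK /stochastic_mxP[_ nu1].
have hE i : initial_prob nu (0, i) *
   \prod_(s < 0) transition w ((0, i) : state d) ((0, i) : state d) = nu 0 i.
  by rewrite big_ord0 mulr1 /initial_prob eqxx.
rewrite -[stay_event A 0 t]setTI.
rewrite (@measure_finType_split _ _ _ K 'I_d.+1 _ _
  (fun i => start_event (fun=> (0, i) : state d) 0)).
- rewrite -sumEFin; apply: eq_bigr => i _.
  by rewrite (quenched_stay_from _ _ _ _ hK) hE.
- exact: measurableT.
- exact: measurable_stay_event.
- by move=> i; exact: measurable_start_event.
- move=> i j _ _ [X [/(_ 0%N isT) Xi /(_ 0%N isT) Xj]].
  by move: Xi; rewrite Xj => -[].
- by [].
- under eq_bigr do rewrite [K _]hK hE.
  rewrite probability_setT sumEFin; congr EFin.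
  have := congr1 (fun M : 'cV_1 => M 0 0) nu1.
  rewrite !mxE => <-.
  by apply: eq_bigr => i _; rewrite mxE mulr1.
Qed.

Lemma survivalS (R : realType) (d : nat) (w : env R d) (t m : nat) :
  survival w t.+1 m = killed_step w (survival w t) m.
Proof. by []. Qed.

(** A nearest-neighbour walk started in the layers [<= 0] cannot pass above layer 1
without visiting it, so [A] is only tested on the layers [<= 1]. *)
Lemma stay_survival (R : realType) (d : nat) (A : pred int) (w : env R d)
    (t m : nat) :
  (forall l : nat, A (- l%:Z)) -> A 1 = false ->
  stay A w t (- m%:Z) = survival w t m.
Proof.
move=> A0 A1; elim: t m => [|t IH] m; rewrite [stay _ _ _ _]/= A0//.
rewrite /walk_step survivalS /killed_step.
have -> : - m%:Z - 1 = - m.+1%:Z by rewrite -addn1 PoszD opprD.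
rewrite !IH; congr (_ *m _ + _ + _).
case: m => [|m]; first by rewrite oppr0 add0r; case: t {IH} => [|t] /=; rewrite A1.
by rewrite -IH; congr (stay A w t _); rewrite -addn1 PoszD; ring.
Qed.

Lemma quenched_survival (R : realType) (d : nat) (A : pred int) (w : env R d)
    (nu : 'rV[R]_d.+1) (K : probability (trajectory d) R) (t : nat) :
  (forall l : nat, A (- l%:Z)) -> A 1 = false ->
  quenched_law w nu K -> stochastic_mx nu ->
  K (stay_event A 0 t) = ((nu *m survival w t 0) 0 0)%:E.
Proof.
move=> A0 A1 hK nu1; rewrite (quenched_stay _ _ hK nu1) mxE; congr EFin.
by apply: eq_bigr => i _; rewrite -(@stay_survival _ _ A)// oppr0.
Qed.

(** * The quenched mean as a series *)

(** The constant [M] may depend on [k]: in the second bound the limit over [n] is taken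
first. If the sum of [a] is infinite the first bound alone concludes. *)
Lemma eq_nneseries_sandwich (R : realType) (a b : nat -> R) :
  (forall t, 0 <= a t) -> (forall k, 0 <= b k) ->
  (forall n, \sum_(0 <= t < n) a t <= \sum_(0 <= k < n.+1) b k) ->
  (forall k, exists M, forall n,
     \sum_(0 <= l < k.+1) b l <= \sum_(0 <= t < n) a t + M * a n) ->
  a t @[t --> \oo] --> 0 ->
  (\sum_(0 <= t <oo) (a t)%:E = \sum_(0 <= k <oo) (b k)%:E)%E.
Proof.
move=> a0 b0 ab ba alim; apply: le_anti; apply/andP; split; apply: lime_le;
  try by apply: is_cvg_nneseries => n _ _; rewrite lee_fin.
  apply: nearW => n; rewrite sumEFin.
  apply: (@le_trans _ _ (\sum_(0 <= k < n.+1) b k)%:E).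
    by rewrite lee_fin.
  by rewrite -sumEFin; apply: nneseries_lim_ge => k _ _; rewrite lee_fin.
apply: nearW => k; rewrite sumEFin.
have [M hM] := ba k.
have psum n : ((\sum_(0 <= t < n) a t)%:E <= \sum_(0 <= t <oo) (a t)%:E)%E.
  by rewrite -sumEFin; apply: nneseries_lim_ge => t _ _; rewrite lee_fin.
have : (0 <= \sum_(0 <= t <oo) (a t)%:E)%E.
  by apply: nneseries_ge0 => t _ _; rewrite lee_fin.
move: psum; case: (\sum_(0 <= t <oo) (a t)%:E)%E => [s||] psum s0 //; last by rewrite leey.
have lims : s + M * a n @[n --> \oo] --> s.
  rewrite -[X in _ --> X]addr0 -[X in _ + X](mulr0 M).
  by apply: cvgD; [exact: cvg_cst|apply: cvgM => //; exact: cvg_cst].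
rewrite lee_fin -(cvg_lim _ lims)//; apply: limr_ge; first by apply/cvg_ex; exists s.
apply: nearW => n; apply: (@le_trans _ _ (\sum_(0 <= l < k.+1) b l)).
  by rewrite big_nat_recr//= lerDl.
by apply: (le_trans (hM n)); rewrite lerD2r -lee_fin.
Qed.

Lemma quenched_exit_time (R : realType) (d : nat)
    (zeta : env R d -> int -> 'M[R]_d.+1) (w : env R d) (nu : 'rV[R]_d.+1) :
  ladder_env w (zeta w) -> stochastic_mx nu ->
  (nu *m survival w t 0) 0 0 @[t --> \oo] --> 0 ->
  (\sum_(0 <= t <oo) ((nu *m survival w t 0%N) 0 0)%:E =
   \sum_i ((nu 0 i)%:E * \sum_(0 <= k <oo) (series_term zeta w k i 0)%:E))%E.
Proof.
move=> hz /stochastic_mxP[nu0 _] hlim.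
have term0 k i : 0 <= series_term zeta w k i 0.
  by have := series_term_ge0 k hz i 0; rewrite mxE.
have nui i : 0 <= nu 0 i by have := nu0 0 i; rewrite mxE.
transitivity (\sum_(0 <= k <oo) ((nu *m series_term zeta w k) 0 0)%:E)%E; last first.
  rewrite [RHS](eq_bigr (fun i => \sum_(0 <= k <oo)
      ((nu 0 i)%:E * (series_term zeta w k i 0)%:E))%E); last first.
    by move=> i _; rewrite nneseriesZl// => k _; rewrite lee_fin.
  rewrite -nneseries_sum; last by move=> i k _; rewrite -EFinM lee_fin mulr_ge0.
  apply: eq_eseriesr => k _; rewrite mxE -sumEFin.
  by apply: eq_bigr => i _; rewrite EFinM.
have ge00 (v : 'cV[R]_d.+1) : lemx 0 v -> 0 <= (nu *m v) 0 0.
  by move=> v0; have := mulmx_ge0 nu0 v0 0 0; rewrite mxE.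
apply: eq_nneseries_sandwich => //.
- by move=> t; apply: ge00; exact: survival_ge0.
- by move=> k; apply: ge00; exact: series_term_ge0.
- move=> n; rewrite -!summxE -!mulmx_sumr.
  apply: (lemx_mul2l nu0); rewrite -/(occupation w n 0).
  rewrite -partial_time_series -exit_time0; exact: occupation_le_exit_time.
- move=> k; have [M hM] := exit_time_bounded k hz.
  exists M => n; rewrite -!summxE -!mulmx_sumr.
  have -> : M * (nu *m survival w n 0) 0 0 = (nu *m (M *: survival w n 0)) 0 0.
    by rewrite -scalemxAr [RHS]mxE.
  have -> (x y : 'cV[R]_d.+1) : (nu *m x) 0 0 + (nu *m y) 0 0 = (nu *m (x + y)) 0 0.
    by rewrite mulmxDr [RHS]mxE.
  apply: (lemx_mul2l nu0); rewrite -partial_time_series -exit_time0.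
  exact: exit_time_le_occupation.
Qed.

(** * Integrals of functions that need not be measurable *)

(** The integral of a non-negative function is a supremum over the simple functions
below it, hence monotone without any measurability. *)
Lemma ge0_le_integral_nonmeas (d : measure_display) (T : measurableType d)
    (R : realType) (mu : {measure set T -> \bar R}) (f g : T -> \bar R) :
  (forall x, 0 <= f x)%E -> (forall x, f x <= g x)%E ->
  (\int[mu]_x f x <= \int[mu]_x g x)%E.
Proof.
move=> f0 fg; rewrite !ge0_integralTE// => [|x]; last exact: le_trans (fg x).
apply: le_ereal_sup => _ [h hf <-]; exists h => // x.
exact: le_trans (hf x) (fg x).
Qed.

(** Up to a null set [N], [g] lies between [f] set to 0 on [N] and [f] set to [+oo] on
[N], which are measurable and have the same integral. *)
Lemma integral_ae_nonmeas (d : measure_display) (T : measurableType d)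
    (R : realType) (mu : {measure set T -> \bar R}) (f g : T -> \bar R) :
  measurable_fun [set: T] f -> (forall x, 0 <= f x)%E -> {ae mu, forall x, f x = g x} ->
  (\int[mu]_x f x = \int[mu]_x g x)%E.
Proof.
move=> mf f0 [N [mN N0 fgN]].
have fg x : x \notin N -> f x = g x.
  by rewrite notin_setE => xN; apply: contrapT => h; apply: xN; exact: fgN.
pose top : T -> \bar R := cst +oo%E \_ N.
have top0 x : (0 <= top x)%E by rewrite /top patchE; case: ifP; rewrite /= ?leey.
have mtop : measurable_fun [set: T] top.
  by apply/(measurable_restrictT _ mN); exact: measurable_cst.
have itop : (\int[mu]_x top x = 0)%E.
  by rewrite /top -integral_mkcond integral_cst// N0 mule0.
have mNC : measurable (~` N) by exact: measurableC.
pose lo : T -> \bar R := f \_ (~` N).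
have lo0 x : (0 <= lo x)%E by rewrite /lo patchE; case: ifP.
have mlo : measurable_fun [set: T] lo.
  by apply/(measurable_restrictT _ mNC); exact: measurable_funTS.
have ilo : (\int[mu]_x f x = \int[mu]_x lo x)%E.
  by rewrite /lo -integral_mkcond (ge0_negligible_integral mN)// setTD.
have loE x : lo x = if x \in N then 0%E else f x.
  by rewrite /lo patchE in_setC; case: (x \in N).
have topE x : top x = if x \in N then +oo%E else 0%E by rewrite /top patchE.
have ipos : (\int[mu]_x f x = \int[mu]_x g^\+ x)%E.
  apply: le_anti; apply/andP; split.
    rewrite ilo; apply: ge0_le_integral_nonmeas => // x; rewrite loE.
    by case: ifPn => // /fg ->; rewrite funeposE le_max lexx.
  have -> : (\int[mu]_x f x = \int[mu]_x (lo x + top x))%E.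
    by rewrite ge0_integralD// itop adde0.
  apply: ge0_le_integral_nonmeas => // x; rewrite loE topE.
  case: ifPn => [_|xN]; first by rewrite add0e leey.
  by rewrite adde0 funeposE -fg// max_l.
have ineg : (\int[mu]_x g^\- x = 0)%E.
  apply: le_anti; rewrite integral_ge0// andbT -itop.
  apply: ge0_le_integral_nonmeas => // x; rewrite topE.
  case: ifPn => [_|xN]; first by rewrite leey.
  by rewrite funenegE -fg// ge_max lexx oppe_le0 f0.
by rewrite [RHS]integralE ipos ineg sube0.
Qed.

(** * From the quenched to the annealed law *)

(** [T_1] is the number of times [t] with [t < T_1]. *)
Lemma hitting_timeE (R : realType) (d : nat) (X : trajectory d) :
  (hitting_time R 1 X =
   \sum_(0 <= t <oo) (\1_(stay_event (fun n => n != 1%R) 0 t) X)%:E)%E.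
Proof.
set E := stay_event _ 0.
have E1 t : E t X -> \1_(E t) X = 1 :> R by move=> h; rewrite indicE mem_set.
have E0 t : ~ E t X -> \1_(E t) X = 0 :> R by move=> h; rewrite indicE memNset.
have ind0 t : (0 <= (\1_(E t) X)%:E :> \bar R)%E by rewrite lee_fin.
have psum n : (forall t, (t < n)%N -> E t X) ->
    (\sum_(0 <= t < n) (\1_(E t) X)%:E = n%:R%:E :> \bar R)%E.
  move=> h; rewrite sumEFin; congr EFin.
  transitivity (\sum_(0 <= t < n) 1 : R); last by rewrite sumr_const_nat subn0.
  by apply: eq_big_nat => t tn; rewrite E1//; exact: h.
have [[t0 Xt0]|noX] := pselect (exists t, (X t).1 == 1).
  have ex : exists t, (X t).1 == 1 by exists t0.
  case: (ex_minnP ex) => t /eqP Xt tmin.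
  have Elt s : (s < t)%N -> E s X.
    move=> st r; rewrite add0n => /andP[_ rs]; apply/negP => /tmin.
    by rewrite leqNgt (leq_ltn_trans rs st).
  have Ege s : (t <= s)%N -> ~ E s X.
    by move=> ts /(_ t); rewrite add0n ts Xt => /(_ isT) /eqP.
  have -> : hitting_time R 1 X = t%:R%:E.
    rewrite /hitting_time; apply: le_anti; apply/andP; split.
      apply: ereal_inf_lbound. exists t; [exact: Xt|by []].
    apply: le_ereal_inf_tmp => _ [s Xs <-]; rewrite lee_fin ler_nat.
    by apply: tmin; apply/eqP; exact: Xs.
  apply: le_anti; apply/andP; split.
    by rewrite -(psum t Elt); apply: nneseries_lim_ge.
  apply: lime_le; first by apply: is_cvg_nneseries.
  apply: nearW => n; have [nt|tn] := leqP n t.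
    by rewrite psum ?lee_fin ?ler_nat// => s sn; apply: Elt; exact: leq_trans nt.
  rewrite (big_cat_nat _ (n := t))//=; last exact: ltnW.
  rewrite psum// [X in (_ + X)%E]big_nat big1 ?adde0// => s /andP[ts _].
  by rewrite E0//; exact: Ege.
have -> : hitting_time R 1 X = +oo%E.
  rewrite /hitting_time (_ : [set _ | _ in _] = set0) ?ereal_inf0//.
  by apply/seteqP; split=> // y [t Xt _]; apply: noX; exists t; apply/eqP; exact: Xt.
(* If layer 1 is never visited, all the indicators equal 1. *)
apply/esym/eqyP => A A0.
apply: (@le_trans _ _ (Num.trunc A).+1%:R%:E).
  by rewrite lee_fin; apply/ltW/truncnS_gt.
rewrite -psum; first by apply: nneseries_lim_ge.
by move=> t _ s _; apply/negP => /eqP Xs; apply: noX; exists s; apply/eqP.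
Qed.

Lemma measurable_site (R : realType) (d : nat) (n : int) (i j : 'I_d.+1) :
  [/\ measurable_fun [set: env R d] (fun w => Pmx w n i j),
      measurable_fun [set: env R d] (fun w => Qmx w n i j) &
      measurable_fun [set: env R d] (fun w => Rmx w n i j)].
Proof.
split=> _ B mB; rewrite setTI; apply: sub_sigma_algebra; exists n, i, j, B;
  split=> //; [exact: Or31|exact: Or32|exact: Or33].
Qed.

Lemma measurable_stay (R : realType) (d : nat) (A : pred int) (t : nat) (n : int)
    (i : 'I_d.+1) :
  measurable_fun [set: env R d] (fun w => stay A w t n i 0).
Proof.
elim: t n i => [|t IH] n i; rewrite /=; case: (A n);
  try (by under eq_fun do rewrite mxE; exact: measurable_cst).
under eq_fun do rewrite /walk_step !mxE.
by repeat apply: measurable_funD; apply: measurable_sum => j;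
   apply: measurable_funM; try exact: IH; case: (measurable_site R n i j).
Qed.

Lemma measurable_quenched_stay (R : realType) (d : nat) (A : pred int) (t : nat)
    (mu : env R d -> 'rV[R]_d.+1) (Pq : env R d -> probability (trajectory d) R) :
  initial_family mu -> (forall w, quenched_law w (mu w) (Pq w)) ->
  measurable_fun [set: env R d] (fun w => Pq w (stay_event A 0 t)).
Proof.
move=> [mu1 mmu] hPq.
under eq_fun => w do rewrite (quenched_stay _ _ (hPq w) (mu1 w)).
apply/measurable_EFinP; apply: measurable_sum => i; apply: measurable_funM => //.
exact: measurable_stay.
Qed.

(** The events [t < T_1] depend on the trajectory only, so the product formula that
characterizes the annealed law suffices. *)
Lemma annealed_hitting_time (R : realType) (d : nat)
    (P : probability (env R d) R) (mu : env R d -> 'rV[R]_d.+1)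
    (Pq : env R d -> probability (trajectory d) R)
    (Pa : probability (env R d * trajectory d)%type R) :
  initial_family mu -> (forall w, quenched_law w (mu w) (Pq w)) ->
  annealed_law P Pq Pa ->
  (\int[Pa]_z hitting_time R 1 z.2 =
   \int[P]_w \sum_(0 <= t <oo) Pq w (stay_event (fun n => n != 1%R) 0 t))%E.
Proof.
move=> hmu hPq hPa; set E := stay_event _ 0.
have mE t : measurable (E t) by exact: measurable_stay_event.
have mTE t : measurable ([set: env R d] `*` E t).
  by apply: measurableX => //; exact: measurableT.
transitivity (\int[Pa]_z \sum_(0 <= t <oo) (\1_([set: env R d] `*` E t) z)%:E)%E.
  apply: eq_integral => z _; rewrite hitting_timeE; apply: eq_eseriesr => t _.
  rewrite !indicE; congr (_%:R%:E); congr nat_of_bool.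
  by apply/idP/idP; rewrite !inE => //= -[].
rewrite !integral_nneseries//.
- apply: eq_eseriesr => t _; rewrite integral_indic// setIT.
  exact: (hPa [set: env R d] (E t) measurableT (mE t)).
- by move=> t; exact: (measurable_quenched_stay _ _ hmu hPq).
- by move=> t; apply/measurable_EFinP; exact: measurable_indic.
Qed.

(** The event of staying forever in the layers [<= 0] excludes convergence to [+oo], so
it is null for the annealed law and therefore for almost every quenched law. *)
Lemma transient_no_trap (R : realType) (d : nat)
    (P : probability (env R d) R) (mu : env R d -> 'rV[R]_d.+1)
    (Pq : env R d -> probability (trajectory d) R)
    (Pa : probability (env R d * trajectory d)%type R) :
  initial_family mu -> (forall w, quenched_law w (mu w) (Pq w)) ->
  annealed_law P Pq Pa -> transient_right Pa ->
  {ae P, forall w, Pq w (stay_event (fun n => n <= 0) 0 t) @[t --> \oo] --> 0%E}.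
Proof.
move=> hmu hPq hPa htrans; set E := stay_event _ 0.
have mE t : measurable (E t) by exact: measurable_stay_event.
pose D := \bigcap_t E t.
have mD : measurable D by exact: bigcapT_measurable.
have cvgD w : Pq w (E t) @[t --> \oo] --> Pq w D.
  apply: nonincreasing_cvg_mu => //.
    by rewrite (le_lt_trans (probability_le1 _ _))// ltry.
  move=> s t st; apply/subsetPset => X hX r /andP[r0 rs]; apply: hX.
  by rewrite r0 (leq_trans rs).
have mPD : measurable_fun [set: env R d] (fun w => Pq w D).
  apply: (emeasurable_fun_cvg (fun t w => Pq w (E t))) => [t|w _]; last exact: cvgD.
  exact: (measurable_quenched_stay _ _ hmu hPq).
have PaD : Pa (setT `*` D) = 0%E.
  case: htrans => N [mN N0 hN]; apply: subset_measure0 N0 => //.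
    by apply: measurableX => //; exact: measurableT.
  move=> [w X] [_ DX]; apply: hN => /= /cvgryPge /(_ 1) [n _ /(_ n (leqnn n))].
  have /= : (X n).1 <= 0 by apply: (DX n I n); rewrite leq0n add0n leqnn.
  by rewrite -(ler_int R) => X0 /le_trans /(_ X0); rewrite ler10.
have : (\int[P]_w `|Pq w D| = 0)%E.
  rewrite -PaD (hPa [set: env R d] D measurableT mD).
  by apply: eq_integral => w _; rewrite gee0_abs.
move/(ae_eq_integral_abs P measurableT mPD); apply: filterS => w /= /(_ I) <-.
exact: cvgD.
Qed.

(** The norm is at most 1, so the integrand is [>= 0], and it equals [+oo] as soon as
some row sum is [>= 1]; a finite integral makes that event null. *)
Lemma ae_site_substochastic (R : realType) (d : nat)
    (P : probability (env R d) R) (n : int) :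
  (\int[P]_w lne ((1 - row_norm (Rmx w n + Qmx w n))%:E^-1) < +oo)%E ->
  {ae P, forall w, forall i, \sum_j (Rmx w n + Qmx w n) i j < 1}.
Proof.
move=> hfin.
pose s (w : env R d) i : R := \sum_j (Rmx w n + Qmx w n) i j.
have ms i : measurable_fun [set: env R d] (fun w => s w i).
  apply: measurable_sum => j; under eq_fun do rewrite mxE.
  by apply: measurable_funD; case: (measurable_site R n i j).
pose N := \bigcup_(i : 'I_d.+1) [set w | 1 <= s w i].
have mN : measurable N.
  apply: fin_bigcup_measurable => [|i _]; first exact: finite_finset.
  rewrite -[X in measurable X]setTI.
  have := ms i measurableT `[1, +oo[%classic (measurable_itv _).
  congr measurable; congr (_ `&` _).
  by apply/seteqP; split=> w /=; rewrite in_itv /= andbT.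
have norm1 (w : env R d) : row_norm (Rmx w n + Qmx w n) <= 1.
  have [p0 q0 r0 prq1] := site_ge0 w n.
  apply/bigmax_leP; split=> // i _.
  have := congr1 (fun M : 'cV_d.+1 => M i 0) prq1; rewrite !mxE => <-.
  apply: ler_sum => j _; rewrite !mxE mulr1 ger0_norm.
    by have := p0 i j; rewrite mxE => ?; lra.
  by have := q0 i j; have := r0 i j; rewrite !mxE => ? ?; lra.
exists N; split=> //; last first.
  move=> w /= /existsNP[i hi]; exists i => //=.
  by rewrite leNgt; exact/negP.
apply: contrapT => /eqP PN.
have : (\int[P]_w (cst +oo%E \_ N) w <=
    \int[P]_w lne ((1 - row_norm (Rmx w n + Qmx w n))%:E^-1))%E.
  apply: ge0_le_integral_nonmeas => w; rewrite patchE.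
    by case: ifP => _ //=; rewrite leey.
  case: ifP => [|_]; last first.
    by rewrite lne_ge0 inve_ge1 lee_fin ?subr_ge0// gerBl; apply: bigmax_ge_id.
  rewrite inE => -[i _ /= si].
  have -> : row_norm (Rmx w n + Qmx w n) = 1.
    apply: le_anti; rewrite norm1/=; exact: le_trans si (row_norm_ge _ i).
  by rewrite subrr inve0.
rewrite -integral_mkcond integral_cst// gt0_mulye ?leye_eq; last first.
  by rewrite lt0e PN measure_ge0.
by move=> /eqP h; move: hfin; rewrite h.
Qed.

Lemma ae_ladder_env (R : realType) (d : nat)
    (P : probability (env R d) R) (zeta : env R d -> int -> 'M[R]_d.+1) :
  conditionC P -> is_zeta P zeta -> {ae P, forall w, ladder_env w (zeta w)}.
Proof.
move=> [_ C2 _ _] hzeta.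
have sub n := @ae_site_substochastic R d P n (C2 n).2.
have subpos := ae_foralln (fun k : nat => sub k%:Z).
have subneg := ae_foralln (fun k : nat => sub (Negz k)).
apply: filterS3 hzeta subpos subneg => w hz hp hn n.
by have [z1 zE] := hz n; split=> //; case: n {z1 zE}.
Qed.

Theorem theorem1p2 (R : realType) (d : nat)
    (P : probability (env R d) R)
    (mu : env R d -> 'rV[R]_d.+1)
    (Pq : env R d -> probability (trajectory d) R)
    (Pa : probability (env R d * trajectory d)%type R)
    (zeta : env R d -> int -> 'M[R]_d.+1)
    (hstat : stationary P)
    (hC : conditionC P)
    (hmu : initial_family mu)
    (hPq : forall w : env R d, quenched_law w (mu w) (Pq w))
    (hPa : annealed_law P Pq Pa)
    (htrans : transient_right Pa)
    (hzeta : is_zeta P zeta) :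
  (\int[Pa]_z hitting_time R 1 z.2 =
   \int[P]_w \sum_i ((mu w 0 i)%:E *
     \sum_(0 <= k <oo) (series_term zeta w k i 0)%:E))%E.
Proof.
rewrite (annealed_hitting_time hmu hPq hPa).
apply: integral_ae_nonmeas.
- apply: ge0_emeasurable_sum => // t _.
  exact: (measurable_quenched_stay _ _ hmu hPq).
- by move=> w; apply: nneseries_ge0.
apply: filterS2 (transient_no_trap hmu hPq hPa htrans) (ae_ladder_env hC hzeta).
move=> w hlim hz; have mu1 := hmu.1 w.
have left0 (l : nat) : (- l%:Z <= 0 :> int) by rewrite oppr_le0.
have left1 (l : nat) : (- l%:Z != 1 :> int) by rewrite lt_eqF// (le_lt_trans (left0 l)).
rewrite -quenched_exit_time//.
  by apply: eq_eseriesr => t _; exact: (quenched_survival t left1 _ (hPq w) mu1).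
move/fine_cvgP: hlim => -[_].
apply: cvg_trans; apply: near_eq_cvg; apply: nearW => t /=.
by rewrite (quenched_survival t left0 _ (hPq w) mu1).
Qed.
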